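(* Let $W$ be an admissible operator space and let $V$ be an operator subspace of $W$. Then $\mathcal E_W(V)$ is the unique minimal, non-empty, two-sided ideal in the semigroup $\mathcal M_W(V)$.
   Context: For operator spaces $V\subseteq W$, a $V$-map is a completely contractive (linear) map $\phi:W\to W$ with $\phi(v)=v$ for all $v\in V$. $\mathcal M_W(V)$ is the set of all $V$-maps, a semigroup under composition with identity $\mathrm{id}_W$. Each $V$-map induces a seminorm $p_\phi(w)=\|\phi(w)\|$ on $W$; these seminorms are ordered pointwise. $W$ is admissible if for every operator subspace $V$ of $W$ and every $V$-map $\phi$ there is a $V$-map $\psi$ with $p_\psi\le p_\phi$ and $p_\psi$ minimal among all $p_\eta$, $\eta$ a $V$-map. $\mathcal E_W(V)$ is the set of minimal $V$-projections, i.e. $V$-maps $E$ with $p_E$ minimal (such $E$ are automatically idempotent). A two-sided ideal of a semigroup $S$ is a subset $J$ with $SJ\subseteq J$ and $JS\subseteq J$. *)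

(* Defs.v *)
From HB Require Import structures.
From mathcomp Require Import all_boot all_order all_algebra.
From mathcomp Require Import complex.
From mathcomp Require Import all_classical all_reals.

Set Implicit Arguments.
Unset Strict Implicit.
Unset Printing Implicit Defensive.

Import Order.TTheory GRing.Theory Num.Theory.
Local Open Scope classical_set_scope.
Local Open Scope ring_scope.

Definition l2norm (R : realType) (n : nat) (v : 'cV[R[i]]_n) : R :=
  Num.sqrt (\sum_i Normc.normc (v i 0) ^+ 2).

(* The norm of a scalar matrix as an operator between the Hilbert spaces C^n
   and C^m. *)
Definition mxopnorm (R : realType) (m n : nat) (a : 'M[R[i]]_(m, n)) : R :=
  sup [set l2norm (a *m v) | v in [set v | l2norm v <= 1]].

(* The product a x b of a matrix x over the vector space W by scalar matrices;
   [*m] does not apply since W is not a ring. *)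
Definition mxbimul (C : pzRingType) (W : lmodType C) (m n p q : nat)
    (a : 'M[C]_(m, n)) (x : 'M[W]_(n, p)) (b : 'M[C]_(p, q)) : 'M[W]_(m, q) :=
  \matrix_(i, j) \sum_k \sum_l (a i k * b l j) *: x k l.

(* Ruan's axioms. Completeness is not required. For n = 0 the axioms force the
   norm on the zero space 'M[W]_0 to vanish, so that index adds nothing. *)
Record operatorSpace (R : realType) : Type := OperatorSpace {
  opspace_sort :> lmodType R[i];
  mxnorm : forall n : nat, 'M[opspace_sort]_n -> R;
  mxnorm_eq0 : forall n (x : 'M[opspace_sort]_n), mxnorm x = 0 -> x = 0;
  mxnormD : forall n (x y : 'M[opspace_sort]_n),
    mxnorm (x + y) <= mxnorm x + mxnorm y;
  mxnormZ : forall n (c : R[i]) (x : 'M[opspace_sort]_n),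
    mxnorm (map_mx (fun w => c *: w) x) = Normc.normc c * mxnorm x;
  mxnorm_dsum : forall m n (x : 'M[opspace_sort]_m) (y : 'M[opspace_sort]_n),
    mxnorm (block_mx x 0 0 y) = Num.max (mxnorm x) (mxnorm y);
  mxnorm_bimul : forall m n (a : 'M[R[i]]_(m, n)) (x : 'M[opspace_sort]_n)
      (b : 'M[R[i]]_(n, m)),
    mxnorm (mxbimul a x b) <= mxopnorm a * mxnorm x * mxopnorm b
}.

Section OperatorSpaces.
Variables (R : realType) (W : operatorSpace R).

Definition opnorm (w : W) : R := mxnorm (const_mx w : 'M[W]_1).

(* An operator subspace carries the matrix norms of W, so it is given by a
   linear subspace; it need not be closed. *)
Definition operator_subspace (V : set W) : Prop :=
  V 0 /\ forall (c : R[i]) (u v : W), V u -> V v -> V (c *: u + v).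

Definition completely_contractive (phi : W -> W) : Prop :=
  forall (n : nat) (x : 'M[W]_n), mxnorm (map_mx phi x) <= mxnorm x.

(* M_W(V), a semigroup under composition by [Vmaps_id] and [Vmaps_comp]. *)
Definition Vmaps (V : set W) : set (W -> W) :=
  [set phi | [/\ linear phi, completely_contractive phi
               & forall v, V v -> phi v = v]].

Definition map_seminorm (phi : W -> W) (w : W) : R := opnorm (phi w).

Definition seminorm_le (p q : W -> R) : Prop := forall w, p w <= q w.

(* E_W(V). Idempotency is not required: minimality of the seminorm implies it. *)
Definition minimal_Vprojections (V : set W) : set (W -> W) :=
  [set E | Vmaps V E /\
     forall eta, Vmaps V eta ->
       seminorm_le (map_seminorm eta) (map_seminorm E) ->
       map_seminorm eta = map_seminorm E].

Lemma Vmaps_id (V : set W) : Vmaps V idfun.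
Proof. by split=> // n x; rewrite map_mx_id. Qed.

Lemma Vmaps_comp (V : set W) (phi psi : W -> W) :
  Vmaps V phi -> Vmaps V psi -> Vmaps V (phi \o psi).
Proof.
move=> [lphi cphi fphi] [lpsi cpsi fpsi]; split.
- by move=> c u v /=; rewrite lpsi lphi.
- by move=> n x; rewrite map_mx_comp (le_trans (cphi _ _)).
- by move=> v Vv /=; rewrite fpsi// fphi.
Qed.

End OperatorSpaces.

Definition admissible (R : realType) (W : operatorSpace R) : Prop :=
  forall V : set W, operator_subspace V ->
  forall phi, Vmaps V phi ->
  exists2 psi, minimal_Vprojections V psi
    & seminorm_le (map_seminorm psi) (map_seminorm phi).

Section Ideals.
Variables (T : Type) (op : T -> T -> T) (S : set T).

Definition two_sided_ideal (J : set T) : Prop :=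
  J `<=` S /\ forall s j, S s -> J j -> J (op s j) /\ J (op j s).

Definition minimal_nonempty_ideal (J : set T) : Prop :=
  [/\ two_sided_ideal J, J !=set0
    & forall K, two_sided_ideal K -> K !=set0 -> K `<=` J -> K = J].

End Ideals.

(* Main.v *)
Require Import Defs.
From mathcomp Require Import all_boot all_order all_algebra.
From mathcomp Require Import complex.
From mathcomp Require Import all_classical all_reals.

(** The engine of the proof is the absorption law [E (phi (E w)) = E w], for a
minimal V-projection [E] and an arbitrary V-map [phi].  It comes from an
averaging argument.  Put [g = E phi] and let [psi_n] be the average of
[E, g E, ..., g^n E].  Each [psi_n] is a V-map, since V-maps form a convex
semigroup, and its seminorm lies below that of [E] because [g] is contractive.
Minimality of [E] forces [psi_n] and [E] to have the same seminorm.  On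
vectors [w - phi (E w)] the average telescopes to
[(E w - g^(n+1) (E w)) / (n+1)], whose norm tends to [0]; hence
[E (w - phi (E w)) = 0].

Absorption yields the ideal property.  That [phi E] is minimal when [E] is holds
because [phi] is contractive.  For [E phi], admissibility provides a minimal
[psi] with seminorm below that of [E phi].  The map [E phi] is idempotent by
absorption, so [psi] kills [w - E phi w]; combined with absorption this gives
[E phi = E phi psi], so that the seminorm of [E phi] lies below that of the
minimal map [psi].

Absorption also shows that every non-empty ideal contains every minimal [E],
as [E = E phi E] for any [phi] in that ideal.  A non-empty ideal
contained in all non-empty ideals is the unique minimal one. *)

Set Implicit Arguments.
Unset Strict Implicit.
Unset Printing Implicit Defensive.

Import Order.TTheory GRing.Theory Num.Theory.
Local Open Scope classical_set_scope.
Local Open Scope ring_scope.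

Lemma normc_invn (R : realType) (n : nat) :
  Normc.normc (n%:R^-1 : R[i]) = n%:R^-1.
Proof. by rewrite Normc.normcV normcMn Normc.normc1. Qed.

Lemma eq0_of_harmonic_bound (R : realType) (a b : R) :
  0 <= a -> (forall n, a <= n.+1%:R^-1 * b) -> a = 0.
Proof.
move=> a0 ab; apply/eqP; rewrite eq_le a0 andbT leNgt; apply/negP => a_gt0.
have b0 : 0 <= b by have := ab 0; rewrite invr1 mul1r; apply: le_trans.
have := ab (Num.bound (b / a)); apply/negP; rewrite -ltNge.
rewrite ltr_pdivrMl// -ltr_pdivrMr//.
rewrite (lt_trans (archi_boundP _)) ?divr_ge0//.
by rewrite ltr_nat.
Qed.

Section OperatorSpaceTheory.
Variables (R : realType) (W : operatorSpace R).
Implicit Types (V : set W) (phi psi E F : W -> W).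

Lemma mxnorm0 m : mxnorm (0 : 'M[W]_m) = 0.
Proof.
have := mxnormZ 0 (0 : 'M[W]_m); rewrite Normc.normc0 mul0r => <-.
by congr mxnorm; apply/matrixP => i j; rewrite !mxE scaler0.
Qed.

Lemma opnorm0 : opnorm (0 : W) = 0.
Proof. exact: mxnorm0. Qed.

Lemma opnorm_eq0 (w : W) : opnorm w = 0 -> w = 0.
Proof. by move=> /mxnorm_eq0/matrixP/(_ 0 0); rewrite !mxE. Qed.

Lemma opnormZ (c : R[i]) (w : W) : opnorm (c *: w) = Normc.normc c * opnorm w.
Proof. by rewrite -mxnormZ map_const_mx. Qed.

Lemma opnormD (u v : W) : opnorm (u + v) <= opnorm u + opnorm v.
Proof.
apply: le_trans (mxnormD _ _); rewrite le_eqVlt; apply/orP; left; apply/eqP.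
by congr mxnorm; apply/matrixP => i j; rewrite !mxE.
Qed.

Lemma opnormN (w : W) : opnorm (- w) = opnorm w.
Proof. by rewrite -scaleN1r opnormZ normcN Normc.normc1 mul1r. Qed.

Lemma opnorm_ge0 (w : W) : 0 <= opnorm w.
Proof.
have := opnormD w (- w).
by rewrite subrr opnorm0 opnormN -mulr2n pmulrn_lge0.
Qed.

(** A convex combination with equal weights: it obeys any common bound on the
matrix norms of its terms, which is why averages of V-maps are V-maps. *)
Definition average (f : nat -> W -> W) (n : nat) (w : W) : W :=
  n.+1%:R^-1 *: \sum_(0 <= k < n.+1) f k w.

Lemma mxnorm_average m f n (x : 'M[W]_m) (b : R) :
  (forall k, mxnorm (map_mx (f k) x) <= b) ->
  mxnorm (map_mx (average f n) x) <= b.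
Proof.
move=> fb.
have -> : map_mx (average f n) x =
    map_mx (fun w => (n.+1%:R^-1 : R[i]) *: w)
      (\sum_(0 <= k < n.+1) map_mx (f k) x).
  apply/matrixP => i j; rewrite !mxE summxE /average; congr (_ *: _).
  by apply: eq_bigr => k _; rewrite mxE.
rewrite mxnormZ normc_invn ler_pdivrMl ?ltr0n//.
elim: n.+1 => [|p IHp]; first by rewrite big_nil mxnorm0 mul0r.
by rewrite big_nat_recr//= (le_trans (mxnormD _ _))// -natr1 mulrDl mul1r lerD.
Qed.

Lemma opnorm_average f n (w : W) (b : R) :
  (forall k, opnorm (f k w) <= b) -> opnorm (average f n w) <= b.
Proof.
move=> fb; rewrite /opnorm -(map_const_mx (average f n)).
by apply: mxnorm_average => k; rewrite map_const_mx; apply: fb.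
Qed.

Lemma Vmaps_average V f n :
  (forall k, Vmaps V (f k)) -> Vmaps V (average f n).
Proof.
move=> Vf; split.
- move=> c u v; rewrite /average /= scalerA mulrC -scalerA -scalerDr.
  congr (_ *: _).
  rewrite scaler_sumr -big_split/=; apply: eq_bigr => k _.
  by have [-> _ _] := Vf k.
- move=> m x; apply: mxnorm_average => k.
  by have [_ + _] := Vf k; apply.
- move=> v Vv; rewrite /average.
  rewrite (eq_bigr (fun=> v)); last by move=> k _; have [_ _ ->] := Vf k.
  rewrite big_const_nat subn0 iter_addr_0 -(scaler_nat n.+1 v) scalerA.
  by rewrite mulVf ?scale1r// pnatr_eq0.
Qed.

Lemma VmapsB V phi u v : Vmaps V phi -> phi (u - v) = phi u - phi v.
Proof.
by move=> [lphi _ _]; rewrite addrC -scaleN1r lphi scaleN1r addrC.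
Qed.

Lemma Vmaps_contractive V phi w : Vmaps V phi -> opnorm (phi w) <= opnorm w.
Proof.
by move=> [_ /(_ 1 (const_mx w)) + _]; rewrite map_const_mx.
Qed.

Lemma Vmaps_iter V phi k : Vmaps V phi -> Vmaps V (iter k phi).
Proof.
move=> Vphi; elim: k => [|k IHk]; first exact: Vmaps_id.
exact: (Vmaps_comp Vphi IHk).
Qed.

Lemma minimal_Vprojections_le V E psi : minimal_Vprojections V E ->
  Vmaps V psi -> seminorm_le (map_seminorm psi) (map_seminorm E) ->
  minimal_Vprojections V psi.
Proof.
move=> [VE minE] Vpsi psiE; split=> // eta Veta etapsi.
by move: etapsi; rewrite (minE _ Vpsi psiE) => /(minE _ Veta).
Qed.

(** The absorption law.  The averages of [E, g E, ..., g^n E], where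
[g = E phi], are competitors for the minimality of [E] that are small on
[w - phi (E w)]. *)
Lemma minimal_Vprojection_absorb V E phi (w : W) :
  minimal_Vprojections V E -> Vmaps V phi -> E (phi (E w)) = E w.
Proof.
move=> [VE minE] Vphi.
pose g := E \o phi; pose f k := iter k g \o E.
have Vg : Vmaps V g := Vmaps_comp VE Vphi.
have Vf k : Vmaps V (f k) := Vmaps_comp (Vmaps_iter k Vg) VE.
have avgE n : map_seminorm (average f n) = map_seminorm E.
  apply: minE; first exact: Vmaps_average.
  move=> u; apply: opnorm_average => k.
  exact: Vmaps_contractive (Vmaps_iter k Vg).
suff : opnorm (E (w - phi (E w))) = 0.
  by move=> /opnorm_eq0/eqP; rewrite (VmapsB _ _ VE) subr_eq0 => /eqP <-.
apply: (@eq0_of_harmonic_bound _ _ (opnorm (E w) *+ 2)) => [|n].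
  exact: opnorm_ge0.
rewrite -[leLHS]/(map_seminorm E _) -(avgE n) /map_seminorm /average.
have -> : \sum_(0 <= k < n.+1) f k (w - phi (E w)) = E w - iter n.+1 g (E w).
  rewrite (eq_bigr (fun k => - (f k.+1 w - f k w))) => [|k _].
    by rewrite sumrN telescope_sumr// opprB.
  by rewrite opprB (VmapsB _ _ (Vf k)) /f /= -iterS iterSr.
rewrite opnormZ normc_invn ler_pM2l ?invr_gt0 ?ltr0n//.
rewrite (le_trans (opnormD _ _))// opnormN mulr2n lerD2l.
exact: Vmaps_contractive (Vmaps_iter _ Vg).
Qed.

Lemma minimal_Vprojection_compl V E phi :
  minimal_Vprojections V E -> Vmaps V phi ->
  minimal_Vprojections V (phi \o E).
Proof.
move=> mE Vphi; apply: (minimal_Vprojections_le mE).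
  by apply: Vmaps_comp => //; case: mE.
by move=> w; apply: Vmaps_contractive Vphi.
Qed.

(** Unlike post-composition, pre-composition with [phi] need not lower the
seminorm of [E], so minimality has to be transferred from a minimal map lying
below [E phi], whose existence is what admissibility provides. *)
Lemma minimal_Vprojection_compr V E phi :
  admissible W -> operator_subspace V ->
  minimal_Vprojections V E -> Vmaps V phi ->
  minimal_Vprojections V (E \o phi).
Proof.
move=> admW opV mE Vphi; have [VE _] := mE.
have VEphi := Vmaps_comp VE Vphi.
have [psi mpsi psi_le] := admW V opV _ VEphi.
have [Vpsi _] := mpsi.
apply: (minimal_Vprojections_le mpsi) => // w.
(* [w - E phi w] lies in the kernel of the idempotent [E phi], and the
   inequality of seminorms sends that kernel into the kernel of [psi]. *)
have psiK : psi (E (phi w)) = psi w.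
  apply/eqP; rewrite eq_sym -subr_eq0 -(VmapsB _ _ Vpsi); apply/eqP/opnorm_eq0.
  apply/eqP; rewrite eq_le opnorm_ge0 andbT (le_trans (psi_le _))//.
  rewrite /map_seminorm (VmapsB _ _ VEphi) /=.
  by rewrite (minimal_Vprojection_absorb _ mE Vphi) subrr opnorm0.
have Ephi_psi : E (phi (psi w)) = E (phi w).
  rewrite -psiK.
  exact: (minimal_Vprojection_absorb _ mE (Vmaps_comp Vphi Vpsi)).
rewrite /map_seminorm /= -Ephi_psi.
exact: Vmaps_contractive VEphi.
Qed.

Lemma two_sided_ideal_minimal_Vprojections V :
  admissible W -> operator_subspace V ->
  two_sided_ideal (fun phi psi : W -> W => phi \o psi)
    (Vmaps V) (minimal_Vprojections V).
Proof.
move=> admW opV; split=> [E []//|phi E Vphi mE]; split.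
- exact: minimal_Vprojection_compl.
- exact: minimal_Vprojection_compr.
Qed.

Lemma minimal_Vprojections_sub_ideal V (J : set (W -> W)) :
  two_sided_ideal (fun phi psi : W -> W => phi \o psi) (Vmaps V) J ->
  J !=set0 -> minimal_Vprojections V `<=` J.
Proof.
move=> [JV idJ] [phi Jphi] E mE; have [VE _] := mE.
have -> : E = (E \o phi) \o E.
  by apply/funext => w /=; rewrite (minimal_Vprojection_absorb _ mE (JV _ Jphi)).
by apply: (idJ _ _ VE _).2; apply: (idJ _ _ VE _).1.
Qed.

End OperatorSpaceTheory.

Theorem proposition2p11 (R : realType) (W : operatorSpace R) (V : set W) :
  admissible W -> operator_subspace V ->
  minimal_nonempty_ideal (fun phi psi : W -> W => phi \o psi)
    (Vmaps V) (minimal_Vprojections V) /\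
  forall J : set (W -> W),
    minimal_nonempty_ideal (fun phi psi : W -> W => phi \o psi) (Vmaps V) J ->
    J = minimal_Vprojections V.
Proof.
move=> admW opV.
have idE := two_sided_ideal_minimal_Vprojections admW opV.
have [E0 mE0 _] := admW V opV _ (Vmaps_id V).
have neE : minimal_Vprojections V !=set0 by exists E0.
split.
- split=> // K idK neK KE; apply/seteqP; split=> //.
  exact: minimal_Vprojections_sub_ideal.
- move=> J [idJ neJ minJ]; apply/esym/minJ => //.
  exact: minimal_Vprojections_sub_ideal.
Qed.
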